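(* Let $\omega\in\mathbb{R}$, let $V(x)=-\omega^2\cos x$ on $\mathbb{T}=\mathbb{R}/(2\pi\mathbb{Z})$, and let $L=-(-\Delta)^{1/2}-V'(x)\,\partial_x$. Let $N\ge1$ and $\mathcal{T}_N^+=\mathrm{span}_{\mathbb{C}}\{e^{inx}:1\le n\le N\}$. Then for all $f\in\mathcal{T}_N^+$ and all $x\in\mathbb{T}$, $$\Gamma_{L,2}(f,f)(x)-\Gamma_{1,2}(f,f)(x)=\frac{\omega^2}{2}\cos(x)\,\Gamma(f,f)(x).$$ For each $x\in\mathbb{T}$, the eigenvalues of the curvature operator $\Gamma^{-1}\Gamma_{L,2}$ on $\mathcal{T}_N^+$ at $x$ are $\kappa_k(x)=(2k-1)+\frac{\omega^2}{2}\cos x$, $k=1,\dots,N$, and the Bakry–Émery curvature of $L$ on $\mathcal{T}_N^+$ is $$\kappa(1,\omega^2)=1-\frac{\omega^2}{2},$$ independent of $N$. In particular, if $\omega^2<2$, then $L$ satisfies $\mathrm{CD}(1-\omega^2/2,\infty)$.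
   Context: $L_1=-(-\Delta)^{1/2}$ acts by $L_1(e^{inx})=-|n|e^{inx}$, $n\in\mathbb{Z}$. The sesquilinear carré du champ $\Gamma$ of $L_1$ (linear in the first argument, conjugate-linear in the second; it is also the carré du champ of $L$) satisfies $\Gamma(e^{in\cdot},e^{im\cdot})(x)=e^{i(n-m)x}\,\tfrac12(|n|+|m|-|n-m|)$. The iterated carrés du champ are $$\Gamma_{1,2}(f,f)=\tfrac12\bigl[L_1\Gamma(f,f)-\Gamma(f,L_1f)-\Gamma(L_1f,f)\bigr],$$ $$\Gamma_{L,2}(f,f)=\Gamma_{1,2}(f,f)+\tfrac12\bigl[b\,\partial_x\Gamma(f,f)-\Gamma(f,b\,\partial_xf)-\Gamma(b\,\partial_xf,f)\bigr],\qquad b(x)=-V'(x)=-\omega^2\sin x.$$ For fixed $x$, $f\mapsto\Gamma(f,f)(x)$ and $f\mapsto\Gamma_{L,2}(f,f)(x)$ are Hermitian quadratic forms in the coefficients $(a_1,\dots,a_N)\in\mathbb{C}^N$ of $f=\sum_{n=1}^Na_ne^{inx}$, with Hermitian matrices $G(x)$ (positive definite) and $G_2(x)$; the curvature operator at $x$ is $G(x)^{-1}G_2(x)$. The Bakry–Émery curvature on $\mathcal{T}_N^+$ is the largest $\kappa$ with $\Gamma_{L,2}(f,f)(x)\ge\kappa\,\Gamma(f,f)(x)$ for all $f\in\mathcal{T}_N^+$, $x\in\mathbb{T}$. $\mathrm{CD}(\kappa,\infty)$ means $\Gamma_{L,2}(f,f)(x)\ge\kappa\,\Gamma(f,f)(x)$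 for all $x\in\mathbb{T}$ and all real-valued trigonometric polynomials $f$. *)

(* Defs.v *)
From HB Require Import structures.
From mathcomp Require Import all_boot all_order all_algebra.
From mathcomp Require Import complex.
From mathcomp Require Import all_classical all_reals all_analysis.
From mathcomp Require Import ring zify.

Set Implicit Arguments.
Unset Strict Implicit.
Unset Printing Implicit Defensive.

Import Order.TTheory GRing.Theory Num.Theory numFieldNormedType.Exports.

Local Open Scope classical_set_scope.
Local Open Scope ring_scope.

(* Functions on the circle R / (2 pi Z) are represented by their lifts        *)
(* R -> R[i].                                                                 *)

Definition cexp (R : realType) (n : int) (x : R) : R[i] :=
  Complex (cos (n%:~R * x)) (sin (n%:~R * x)).

Definition trig (R : realType) (s : seq (int * R[i])) (x : R) : R[i] :=
  \sum_(p <- s) p.2 * cexp p.1 x.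

Definition trig_poly (R : realType) : set (R -> R[i]) := range (@trig R).

Definition tpoly (R : realType) (N : nat) (a : 'cV[R[i]]_N) (x : R) : R[i] :=
  \sum_(j < N) a j 0 * cexp j.+1%:Z x.

Definition Tplus (R : realType) (N : nat) : set (R -> R[i]) :=
  range (@tpoly R N).

Definition dx (R : realType) (f : R -> R[i]) (x : R) : R[i] :=
  Complex (derive1 (fun y => complex.Re (f y)) x)
          (derive1 (fun y => complex.Im (f y)) x).

Definition circle_integral (R : realType) (f : R -> R[i]) : R[i] :=
  Complex
   (\int[@lebesgue_measure R]_(x in `[0, pi *+ 2]) complex.Re (f x))%R
   (\int[@lebesgue_measure R]_(x in `[0, pi *+ 2]) complex.Im (f x))%R.

Definition fourier (R : realType) (f : R -> R[i]) (n : int) : R[i] :=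
  ((pi *+ 2)^-1)%:C%C * circle_integral (fun x => f x * conjc (cexp n x)).

(* - (- Delta)^(1/2), as a Fourier multiplier. The sum over Z is a finitely   *)
(* supported one (it is 0 by convention when infinitely many terms are not    *)
(* 0): this is the intended operator on trigonometric polynomials, see        *)
(* L1_trig, the only functions it is applied to.                              *)
Definition L1 (R : realType) (f : R -> R[i]) (x : R) : R[i] :=
  \sum_(n \in [set: int]) (- `|n|)%:~R * fourier f n * cexp n x.

Definition potential (R : realType) (w : R) (x : R) : R := - w ^+ 2 * cos x.

Definition drift (R : realType) (w : R) (x : R) : R :=
  - derive1 (potential w) x.

Definition bdx (R : realType) (w : R) (f : R -> R[i]) (x : R) : R[i] :=
  (drift w x)%:C%C * dx f x.

Definition generator (R : realType) (w : R) (f : R -> R[i]) (x : R) : R[i] :=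
  L1 f x + bdx w f x.

(* Carre du champ of A, extended sesquilinearly: conjugate-linear in g.       *)
Definition carre (R : realType) (A : (R -> R[i]) -> R -> R[i])
    (f g : R -> R[i]) (x : R) : R[i] :=
  let gc y := conjc (g y) in
  2^-1 * (A (fun y => f y * gc y) x - f x * A gc x - gc x * A f x).

Definition Gamma (R : realType) : (R -> R[i]) -> (R -> R[i]) -> R -> R[i] :=
  carre (@L1 R).

(* Contribution of A to the iterated carre du champ of an operator whose      *)
(* carre du champ is Gamma. L1 and generator w are such operators             *)
(* (carre_generator), and GammaL2 w is the iterated carre du champ of         *)
(* generator w (GammaL2_generator).                                           *)
Definition iter_carre (R : realType) (A : (R -> R[i]) -> R -> R[i])
    (f g : R -> R[i]) (x : R) : R[i] :=
  2^-1 * (A (Gamma f g) x - Gamma f (A g) x - Gamma (A f) g x).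

Definition Gamma12 (R : realType) : (R -> R[i]) -> (R -> R[i]) -> R -> R[i] :=
  iter_carre (@L1 R).

Definition GammaL2 (R : realType) (w : R) (f g : R -> R[i]) (x : R) : R[i] :=
  Gamma12 f g x + iter_carre (bdx w) f g x.

(* Matrix of a sesquilinear form Q restricted to T_N^+ at x, normalized by    *)
(* Q(f, f)(x) = a^* M a for f = tpoly a: see form_mxP and form_mx_herm. For   *)
(* Q = Gamma it is invertible (Gamma_mx_unit), so that the invmx in           *)
(* curvature_op is a genuine inverse.                                         *)
Definition form_mx (R : realType) (N : nat)
    (Q : (R -> R[i]) -> (R -> R[i]) -> R -> R[i]) (x : R) : 'M[R[i]]_N :=
  \matrix_(j, k) Q (cexp k.+1%:Z) (cexp j.+1%:Z) x.

Definition curvature_op (R : realType) (w : R) (N : nat) (x : R) : 'M[R[i]]_N :=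
  invmx (form_mx N (@Gamma R) x) *m form_mx N (GammaL2 w) x.

(* In R[i], y <= z means that z - y is real and nonnegative.                  *)
Definition curvature_bound (R : realType) (w : R) (N : nat) (kappa : R) : Prop :=
  forall f, Tplus N f -> forall x,
    kappa%:C%C * Gamma f f x <= GammaL2 w f f x.

Definition is_BE_curvature (R : realType) (w : R) (N : nat) (kappa : R) : Prop :=
  curvature_bound w N kappa /\
  forall kappa', curvature_bound w N kappa' -> kappa' <= kappa.

Definition CD (R : realType) (w : R) (kappa : R) : Prop :=
  forall f, @trig_poly R f -> (forall x, f x \is Num.real) -> forall x,
    kappa%:C%C * Gamma f f x <= GammaL2 w f f x.

Lemma driftE (R : realType) (w x : R) : drift w x = - w ^+ 2 * sin x.
Proof.
rewrite /drift derive1E.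
have H : is_derive x 1 (potential w) (- w ^+ 2 * - sin x).
  by rewrite /potential; apply: is_deriveZ.
by rewrite derive_val mulrN opprK.
Qed.

Lemma cexp0 (R : realType) : cexp 0 = (fun=> 1) :> (R -> R[i]).
Proof. by apply/funext => x; rewrite /cexp mul0r cos0 sin0. Qed.

Lemma cexpD (R : realType) (m n : int) (x : R) :
  cexp (m + n) x = cexp m x * cexp n x.
Proof.
rewrite /cexp intrD mulrDl cosD sinD; apply/eqP; rewrite eq_complex /=.
by rewrite eqxx /= addrC [X in _ + X]mulrC [X in X + _]mulrC eqxx.
Qed.

Lemma cexpN (R : realType) (n : int) (x : R) : cexp (- n) x = conjc (cexp n x).
Proof. by rewrite /cexp intrN mulNr cosN sinN. Qed.

Lemma trig_cexp (R : realType) (n : int) : trig [:: (n, 1)] = cexp n :> (R -> R[i]).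
Proof. by apply/funext => x; rewrite /trig big_seq1 mul1r. Qed.

Definition cderive (R : realType) (f : R -> R[i]) (x : R) (d : R[i]) : Prop :=
  is_derive x 1 (fun y => complex.Re (f y)) (complex.Re d) /\
  is_derive x 1 (fun y => complex.Im (f y)) (complex.Im d).

Lemma cderive_dx (R : realType) (f : R -> R[i]) x d : cderive f x d -> dx f x = d.
Proof.
by case: d => a b [[_ /= da] [_ /= db]]; rewrite /dx !derive1E da db.
Qed.

Lemma cderiveD (R : realType) (f g : R -> R[i]) x d e :
  cderive f x d -> cderive g x e -> cderive (fun y => f y + g y) x (d + e).
Proof.
case: d e => [d1 d2] [e1 e2] [/= fr fi] [/= gr gi]; split.
  rewrite (_ : (fun y => _) =
    (fun y => complex.Re (f y)) + (fun y => complex.Re (g y))).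
    exact: is_deriveD.
  by apply/funext => y; rewrite fctE; case: (f y); case: (g y).
rewrite (_ : (fun y => _) =
  (fun y => complex.Im (f y)) + (fun y => complex.Im (g y))).
  exact: is_deriveD.
by apply/funext => y; rewrite fctE; case: (f y); case: (g y).
Qed.

Lemma cderiveZ (R : realType) (c : R[i]) (f : R -> R[i]) x d :
  cderive f x d -> cderive (fun y => c * f y) x (c * d).
Proof.
case: c => a b; case: d => u v [/= fr fi]; split.
  rewrite (_ : (fun y => _) =
    a *: (fun y => complex.Re (f y)) - b *: (fun y => complex.Im (f y))).
    exact: is_deriveB.
  by apply/funext => y; rewrite !fctE; case: (f y).
rewrite (_ : (fun y => _) =
  a *: (fun y => complex.Im (f y)) + b *: (fun y => complex.Re (f y))).
  exact: is_deriveD.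
by apply/funext => y; rewrite !fctE; case: (f y).
Qed.

Lemma cderive_cexp (R : realType) (n : int) (x : R) :
  cderive (cexp n) x (Complex 0 n%:~R * cexp n x).
Proof.
have D0 : is_derive x 1 (fun y : R => n%:~R * y) (n%:~R).
  by rewrite -[X in is_derive _ _ _ X]mulr1; apply: is_deriveZ.
split=> /=; rewrite !mul0r ?add0r ?sub0r.
  rewrite -mulrN mulrC; exact: (is_derive1_comp _ D0).
rewrite mulrC; exact: (is_derive1_comp _ D0).
Qed.

Lemma cderive_id (R : realType) (x : R) :
  cderive (fun y => y%:C%C) x 1.
Proof. by split=> /=; [exact: is_derive_id|exact: is_derive_cst]. Qed.

Lemma cderive_cst (R : realType) (c : R[i]) (x : R) :
  cderive (fun=> c) x 0.
Proof. by split=> /=; exact: is_derive_cst. Qed.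

Lemma trig_cons (R : realType) p (s : seq (int * R[i])) :
  trig (p :: s) = fun x => p.2 * cexp p.1 x + trig s x.
Proof. by apply/funext => x; rewrite /trig big_cons. Qed.

Lemma trig_nil (R : realType) : trig [::] = fun=> 0 :> R[i].
Proof. by apply/funext => x; rewrite /trig big_nil. Qed.

Definition dmap (R : realType) (s : seq (int * R[i])) :=
  [seq (p.1, Complex 0 p.1%:~R * p.2) | p <- s].

Lemma cderive_trig (R : realType) (s : seq (int * R[i])) (x : R) :
  cderive (trig s) x (trig (dmap s) x).
Proof.
elim: s => [|p s IHs]; first by rewrite trig_nil; exact: cderive_cst.
rewrite /= !trig_cons; apply: cderiveD => //=.
by rewrite -mulrA mulrCA; apply: cderiveZ; exact: cderive_cexp.
Qed.

Lemma cexp_2pi (R : realType) (n : int) : cexp n (pi *+ 2) = 1 :> R[i].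
Proof.
have H (k : nat) : cexp k (pi *+ 2) = 1 :> R[i].
  elim: k => [|k IHk]; first by rewrite cexp0.
  by rewrite -addn1 PoszD cexpD IHk mul1r /cexp mul1r cos2pi sin2pi.
by case: n => k //; rewrite NegzE cexpN H /= oppr0.
Qed.

Lemma trig_primitive (R : realType) (s : seq (int * R[i])) :
  exists2 F : R -> R[i], (forall x, cderive F x (trig s x)) &
    F (pi *+ 2) - F 0 = (pi *+ 2)%:C%C * \sum_(p <- s) p.2 * (p.1 == 0)%:R.
Proof.
elim: s => [|[n c] s [F dF eF]].
  exists (fun=> 0); last by rewrite big_nil mulr0 subr0.
  by move=> x; rewrite trig_nil; exact: cderive_cst.
rewrite trig_cons big_cons /=; have [->|n0] := eqVneq n 0.
  exists (fun y => c * y%:C%C + F y).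
    move=> x; apply: cderiveD => //; rewrite cexp0; apply: cderiveZ.
    exact: cderive_id.
  by rewrite opprD addrACA eF /= !mulr0 subr0; ring.
exists (fun y => c / Complex 0 n%:~R * cexp n y + F y).
  move=> x; apply: cderiveD => //.
  have {2}-> : c = c / Complex 0 n%:~R * Complex 0 n%:~R :> R[i].
    by rewrite mulfVK // eq_complex /= eqxx intr_eq0.
  by rewrite -mulrA; apply: cderiveZ; exact: cderive_cexp.
rewrite opprD addrACA eF cexp_2pi.
rewrite (_ : cexp n 0 = 1); last by rewrite /cexp mulr0 cos0 sin0.
by rewrite subrr mulr0 !add0r.
Qed.

Lemma circle_integral_trig (R : realType) (s : seq (int * R[i])) :
  circle_integral (trig s) = (pi *+ 2)%:C%C * \sum_(p <- s) p.2 * (p.1 == 0)%:R.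
Proof.
have [F dF <-] := trig_primitive s.
have ct (x : R) := cderive_trig s x.
have pi0 : 0 < pi *+ 2 :> R by rewrite mulrn_wgt0 // pi_gt0.
have FTC (f G : R -> R) : continuous f -> (forall x : R, is_derive x 1 G (f x)) ->
    (\int[@lebesgue_measure R]_(x in `[0%R, (pi *+ 2)%R]) f x)%R = G (pi *+ 2) - G 0.
  move=> cf dG; rewrite /Rintegral (@continuous_FTC2 _ f G)//.
  - exact: continuous_subspaceT.
  - have cG : continuous G.
      by move=> x; apply/differentiable_continuous/derivable1_diffP.
    split.
    + by move=> x _; exact: ex_derive.
    + by apply: cvg_at_right_filter; exact: cG.
    + by apply: cvg_at_left_filter; exact: cG.
  - by move=> x _; rewrite derive1E derive_val.
have cR : continuous (fun y => complex.Re (trig s y)).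
  by move=> x; apply/differentiable_continuous/derivable1_diffP; case: (ct x).
have cI : continuous (fun y => complex.Im (trig s y)).
  by move=> x; apply/differentiable_continuous/derivable1_diffP; case: (ct x).
rewrite /circle_integral (FTC _ _ cR (fun x => (dF x).1)).
rewrite (FTC _ _ cI (fun x => (dF x).2)).
by case: (F 0); case: (F _).
Qed.

Lemma fourier_trig (R : realType) (s : seq (int * R[i])) (n : int) :
  fourier (trig s) n = \sum_(p <- s) p.2 * (p.1 == n)%:R.
Proof.
rewrite /fourier (_ : (fun x => _) = trig [seq (p.1 - n, p.2) | p <- s]).
  rewrite circle_integral_trig mulrA -rmorphM mulVf ?mul1r.
    by rewrite big_map; apply: eq_bigr => p _ /=; rewrite subr_eq0.
  by rewrite gt_eqF // mulrn_wgt0 // pi_gt0.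
apply/funext => x; rewrite /trig big_map mulr_suml; apply: eq_bigr => p _ /=.
by rewrite cexpD cexpN mulrA.
Qed.

Lemma L1_trig (R : realType) (s : seq (int * R[i])) :
  L1 (trig s) = trig [seq (p.1, (- `|p.1|)%:~R * p.2) | p <- s].
Proof.
apply/funext => x; rewrite /L1 /trig big_map.
rewrite (fsbigE (undup (map fst s))) ?undup_uniq //; last first.
  move=> n _; rewrite mem_undup => /mapP ns.
  rewrite fourier_trig big_seq big1 ?mulr0 ?mul0r // => p ps.
  by case: eqP => [e|_]; [case: ns; exists p|rewrite mulr0].
under eq_bigl do rewrite in_setT.
under eq_bigr => n _ do rewrite fourier_trig mulr_sumr mulr_suml.
rewrite exchange_big /= big_seq [RHS]big_seq; apply: eq_bigr => p ps.
rewrite (bigD1_seq p.1) ?undup_uniq ?mem_undup ?map_f //= eqxx mulr1.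
rewrite big1 ?addr0 // => n np.
by rewrite eq_sym (negbTE np) !mulr0 mul0r.
Qed.

Lemma L1_cexp (R : realType) (n : int) (x : R) :
  L1 (cexp n) x = (- `|n|)%:~R * cexp n x.
Proof. by rewrite -trig_cexp L1_trig /trig !big_seq1 /= mul1r mulr1. Qed.

Lemma trig_polyP (R : realType) (s : seq (int * R[i])) : trig_poly (trig s).
Proof. by exists s. Qed.

Lemma trig_poly_cexp (R : realType) (n : int) : @trig_poly R (cexp n).
Proof. by rewrite -trig_cexp; exact: trig_polyP. Qed.

Lemma trig_scale (R : realType) (c : R[i]) (s : seq (int * R[i])) :
  (fun x => c * trig s x) = trig [seq (p.1, c * p.2) | p <- s].
Proof.
apply/funext => x; rewrite /trig big_map mulr_sumr.
by apply: eq_bigr => p _; rewrite mulrA.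
Qed.

Lemma trig_add (R : realType) (s t : seq (int * R[i])) :
  (fun x => trig s x + trig t x) = trig (s ++ t).
Proof. by apply/funext => x; rewrite /trig big_cat. Qed.

Lemma trig_conj (R : realType) (s : seq (int * R[i])) :
  (fun x => conjc (trig s x)) = trig [seq (- p.1, conjc p.2) | p <- s].
Proof.
apply/funext => x; rewrite /trig big_map rmorph_sum.
by apply: eq_bigr => p _; rewrite rmorphM /= cexpN.
Qed.

Lemma trig_mul (R : realType) (s t : seq (int * R[i])) :
  (fun x => trig s x * trig t x) =
  trig [seq (p.1 + q.1, p.2 * q.2) | p <- s, q <- t].
Proof.
apply/funext => x; rewrite /trig big_allpairs_dep mulr_suml; apply: eq_bigr => p _.
by rewrite mulr_sumr; apply: eq_bigr => q _; rewrite cexpD mulrACA.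
Qed.

Lemma trig_poly_lin (R : realType) (c : R[i]) (f g : R -> R[i]) :
  trig_poly f -> trig_poly g -> trig_poly (fun x => c * f x + g x).
Proof.
move=> [s _ <-] [t _ <-]; have := trig_add [seq (p.1, c * p.2) | p <- s] t.
by rewrite -trig_scale => ->; exact: trig_polyP.
Qed.

Lemma trig_polyM (R : realType) (f g : R -> R[i]) :
  trig_poly f -> trig_poly g -> trig_poly (fun x => f x * g x).
Proof. by move=> [s _ <-] [t _ <-]; rewrite trig_mul; exact: trig_polyP. Qed.

Lemma trig_poly_conj (R : realType) (f : R -> R[i]) :
  trig_poly f -> trig_poly (fun x => conjc (f x)).
Proof. by move=> [s _ <-]; rewrite trig_conj; exact: trig_polyP. Qed.

Lemma trig_poly_drift (R : realType) (w : R) :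
  trig_poly (fun x => (drift w x)%:C%C).
Proof.
exists [:: (1, Complex 0 (w ^+ 2 / 2)); (-1, Complex 0 (- (w ^+ 2 / 2)))] => //.
apply/funext => x; rewrite /trig !big_cons big_nil /= driftE cexpN /cexp !mul1r.
by apply/eqP; rewrite eq_complex /=; apply/andP; split; apply/eqP; field.
Qed.

Definition real_operator (R : realType) (A : (R -> R[i]) -> R -> R[i]) : Prop :=
  [/\ forall f, trig_poly f -> trig_poly (A f),
      forall (c : R[i]) f g, trig_poly f -> trig_poly g ->
        A (fun x => c * f x + g x) = (fun x => c * A f x + A g x) &
      forall f, trig_poly f ->
        A (fun x => conjc (f x)) = (fun x => conjc (A f x))].

Lemma real_operator_L1 (R : realType) : real_operator (@L1 R).
Proof.
split.
- by move=> f [s _ <-]; rewrite L1_trig; exact: trig_polyP.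
- move=> c f g [s _ <-] [t _ <-].
  have := trig_add [seq (p.1, c * p.2) | p <- s] t.
  rewrite -trig_scale => ->; rewrite !L1_trig map_cat -trig_add.
  apply/funext => x; congr (_ + _).
  have := congr1 (@^~ x) (trig_scale c [seq (p.1, (- `|p.1|)%:~R * p.2) | p <- s]).
  move=> /= ->; rewrite -!map_comp; congr (trig _ x).
  by apply: eq_map => p /=; rewrite mulrCA.
- move=> f [s _ <-]; rewrite trig_conj !L1_trig trig_conj -!map_comp.
  congr trig; apply: eq_map => p /=.
  by rewrite rmorphM /= normrN rmorph_int.
Qed.

Lemma dx_trig (R : realType) (s : seq (int * R[i])) :
  dx (trig s) = trig (dmap s).
Proof. by apply/funext => x; apply: cderive_dx; exact: cderive_trig. Qed.

Lemma real_operator_bdx (R : realType) (w : R) : real_operator (bdx w).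
Proof.
split.
- move=> f [s _ <-]; rewrite /bdx dx_trig.
  by apply: trig_polyM; [exact: trig_poly_drift|exact: trig_polyP].
- move=> c f g [s _ <-] [t _ <-]; apply/funext => x; rewrite /bdx.
  rewrite (_ : dx _ x = c * dx (trig s) x + dx (trig t) x); first by ring.
  rewrite !dx_trig; apply: cderive_dx; apply: cderiveD; last exact: cderive_trig.
  by apply: cderiveZ; exact: cderive_trig.
- move=> f [s _ <-]; rewrite trig_conj; apply/funext => x.
  rewrite /bdx !dx_trig rmorphM /= oppr0; congr (_ * _).
  have := congr1 (@^~ x) (trig_conj (dmap s)) => /= ->.
  rewrite /dmap -!map_comp; congr (trig _ x); apply: eq_map => p /=.
  by rewrite rmorphM /= intrN.
Qed.

Lemma real_operator_generator (R : realType) (w : R) : real_operator (generator w).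
Proof.
have [T1 l1 c1] := real_operator_L1 R; have [T2 l2 c2] := real_operator_bdx w.
split.
- move=> f Tf; rewrite /generator.
  by have := trig_poly_lin 1 (T1 _ Tf) (T2 _ Tf); under eq_fun do rewrite mul1r.
- by move=> c f g Tf Tg; apply/funext => x; rewrite /generator l1 // l2 //; ring.
- by move=> f Tf; apply/funext => x; rewrite /generator c1 // c2 // rmorphD.
Qed.

Lemma Gamma_cexp (R : realType) (n m : int) (x : R) :
  Gamma (cexp n) (cexp m) x =
  cexp (n - m) x * (2^-1 * (`|n| + `|m| - `|n - m|)%:~R).
Proof.
rewrite /Gamma /carre.
have cm : (fun y : R => conjc (cexp m y)) = cexp (- m).
  by apply/funext => y; rewrite cexpN.
rewrite cm -cexpN.
rewrite (_ : (fun y => _) = cexp (n - m)); last first.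
  by apply/funext => y; rewrite -cexpN -cexpD.
rewrite !L1_cexp cexpD normrN !intrD !intrN.
ring.
Qed.

Lemma dxM (R : realType) (f g : R -> R[i]) (x : R) :
  trig_poly f -> trig_poly g ->
  dx (fun y => f y * g y) x = f x * dx g x + g x * dx f x.
Proof.
move=> [s _ <-] [t _ <-]; rewrite trig_mul !dx_trig.
have := congr1 (@^~ x) (trig_mul s (dmap t)) => /= ->.
have := congr1 (@^~ x) (trig_mul (dmap s) t) => /=; rewrite mulrC => ->.
rewrite /trig /dmap big_map !big_allpairs_dep /= big_map -big_split /=.
apply: eq_bigr => p _ /=; rewrite big_map -big_split; apply: eq_bigr => q _ /=.
rewrite -mulrDl; congr (_ * _).
rewrite (_ : Complex 0 _ = Complex 0 p.1%:~R + Complex 0 q.1%:~R :> R[i]).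
  ring.
by apply/eqP; rewrite eq_complex /= addr0 intrD !eqxx.
Qed.

Lemma carre_generator (R : realType) (w : R) (f g : R -> R[i]) :
  trig_poly f -> trig_poly g -> carre (generator w) f g = Gamma f g.
Proof.
move=> Tf Tg; apply/funext => x; rewrite /Gamma /carre /generator /bdx.
rewrite dxM //; last exact: trig_poly_conj.
ring.
Qed.

Definition sesquilinear_on_trig (R : realType)
    (Q : (R -> R[i]) -> (R -> R[i]) -> R -> R[i]) : Prop :=
  [/\ forall f g, trig_poly f -> trig_poly g -> trig_poly (Q f g),
      forall (c : R[i]) f1 f2 g, trig_poly f1 -> trig_poly f2 -> trig_poly g ->
        Q (fun x => c * f1 x + f2 x) g = (fun x => c * Q f1 g x + Q f2 g x) &
      forall f g, trig_poly f -> trig_poly g ->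
        Q g f = (fun x => conjc (Q f g x))].

Lemma conjcV2 (R : realType) (z : R[i]) : conjc (2^-1 * z) = 2^-1 * conjc z.
Proof. by rewrite rmorphM fmorphV rmorph_nat. Qed.

Lemma trig_poly_ext (R : realType) (f g : R -> R[i]) :
  trig_poly f -> f =1 g -> trig_poly g.
Proof. by move=> Tf /funext <-. Qed.

Lemma sesquilinear_carre (R : realType) A :
  real_operator A -> sesquilinear_on_trig (@carre R A).
Proof.
move=> [TA lA cA]; split.
- move=> f g Tf Tg; have Tc := trig_poly_conj Tg.
  have H1 := TA _ (trig_polyM Tf Tc).
  have H2 := trig_polyM Tf (TA _ Tc); have H3 := trig_polyM Tc (TA _ Tf).
  have H4 := trig_poly_lin (-1) H2 (trig_poly_lin (-1) H3 H1).
  apply: trig_poly_ext (trig_poly_lin (2^-1) H4 (trig_poly_lin (-1) H1 H1)) _.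
  by move=> x; rewrite /carre; ring.
- move=> c f1 f2 g T1 T2 Tg; apply/funext => x; rewrite /carre.
  have Tc := trig_poly_conj Tg.
  rewrite lA // (_ : (fun y => (c * f1 y + f2 y) * _) = (fun y =>
    c * (f1 y * conjc (g y)) + f2 y * conjc (g y))).
    by rewrite lA; [ring|exact: trig_polyM|exact: trig_polyM].
  by apply/funext => y; ring.
- move=> f g Tf Tg; apply/funext => x; rewrite /carre conjcV2.
  have e : A (fun y => g y * conjc (f y)) x =
           conjc (A (fun y => f y * conjc (g y)) x).
    rewrite -[RHS]/((fun y => conjc (A _ y)) x) -cA.
      by congr (A _ x); apply/funext => y; rewrite rmorphM /= conjcK mulrC.
    by apply: trig_polyM => //; exact: trig_poly_conj.
  by rewrite e !rmorphB !rmorphM /= !cA // !conjcK; ring.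
Qed.

Lemma sesquilinear_Gamma (R : realType) : sesquilinear_on_trig (@Gamma R).
Proof. exact: sesquilinear_carre (@real_operator_L1 R). Qed.

Lemma lin_comb3 (K : comPzRingType) (k c a1 a2 b1 b2 d1 d2 : K) :
  k * ((c * a1 + a2) - (c * b1 + b2) - (c * d1 + d2)) =
  c * (k * (a1 - b1 - d1)) + k * (a2 - b2 - d2).
Proof. ring. Qed.

Lemma sesquilinear_iter_carre (R : realType) A :
  real_operator A -> sesquilinear_on_trig (@iter_carre R A).
Proof.
move=> [TA lA cA]; have [TG lG cG] := sesquilinear_Gamma R; split.
- move=> f g Tf Tg.
  have H1 := TA _ (TG _ _ Tf Tg).
  have H2 := TG _ _ Tf (TA _ Tg); have H3 := TG _ _ (TA _ Tf) Tg.
  have H4 := trig_poly_lin (-1) H2 (trig_poly_lin (-1) H3 H1).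
  apply: trig_poly_ext (trig_poly_lin (2^-1) H4 (trig_poly_lin (-1) H1 H1)) _.
  by move=> x; rewrite /iter_carre; ring.
- move=> c f1 f2 g T1 T2 Tg; apply/funext => x; rewrite /iter_carre.
  have TAg := TA _ Tg; have TA1 := TA _ T1; have TA2 := TA _ T2.
  have TG1 := TG _ _ T1 Tg; have TG2 := TG _ _ T2 Tg.
  by rewrite lA // (lG c _ _ g T1 T2 Tg) lA // (lG c _ _ _ T1 T2 TAg)
    (lG c _ _ g TA1 TA2 Tg) lin_comb3.
- move=> f g Tf Tg; apply/funext => x; rewrite /iter_carre conjcV2.
  rewrite !rmorphB /= (cG _ _ Tf Tg) cA; last exact: TG.
  by rewrite (cG _ _ Tf (TA _ Tg)) (cG _ _ (TA _ Tf) Tg); ring.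
Qed.

Lemma sesquilinear_GammaL2 (R : realType) (w : R) :
  sesquilinear_on_trig (GammaL2 w).
Proof.
have [T1 l1 c1] := sesquilinear_iter_carre (@real_operator_L1 R).
have [T2 l2 c2] := sesquilinear_iter_carre (real_operator_bdx w).
split; rewrite /GammaL2 /Gamma12.
- move=> f g Tf Tg; apply: trig_poly_ext (trig_poly_lin 1 (T1 _ _ Tf Tg) (T2 _ _ Tf Tg)) _.
  by move=> x; rewrite mul1r.
- move=> c f1 f2 g Tf1 Tf2 Tg; apply/funext => x.
  by rewrite (l1 c f1 f2 g) // (l2 c f1 f2 g) // mulrDr addrACA.
- move=> f g Tf Tg; apply/funext => x.
  by rewrite (c1 f g) // (c2 f g) // rmorphD.
Qed.

Lemma GammaL2_generator (R : realType) (w : R) (f g : R -> R[i]) (x : R) :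
  trig_poly f -> trig_poly g ->
  GammaL2 w f g x =
  2^-1 * (generator w (carre (generator w) f g) x
          - carre (generator w) f (generator w g) x - carre (generator w) (generator w f) g x).
Proof.
move=> Tf Tg; have [T0 _ _] := real_operator_generator w.
have [T1 _ _] := real_operator_L1 R; have [T2 _ _] := real_operator_bdx w.
have [_ lG cG] := sesquilinear_Gamma R.
have LE (h : R -> R[i]) : generator w h = (fun y => 1 * L1 h y + bdx w h y).
  by apply/funext => y; rewrite mul1r.
rewrite !carre_generator ?T0 //; try exact: T0.
have -> : Gamma f (generator w g) x = Gamma f (L1 g) x + Gamma f (bdx w g) x.
  rewrite (cG (generator w g)) //; last exact: T0.
  rewrite LE lG //; [|exact: T1|exact: T2].
  rewrite mul1r rmorphD /=.
  by rewrite (cG _ f (T1 _ Tg) Tf) (cG _ f (T2 _ Tg) Tf).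
have -> : Gamma (generator w f) g x = Gamma (L1 f) g x + Gamma (bdx w f) g x.
  by rewrite LE lG //; [rewrite mul1r|exact: T1|exact: T2].
rewrite /GammaL2 /Gamma12 /iter_carre [generator w _ x]/generator -mulrDr -[X in X + _]mul1r.
by rewrite mulrDr -[in RHS](mul1r (L1 _ x)) -[in RHS](mul1r (Gamma _ (L1 g) x))
  -[in RHS](mul1r (Gamma (L1 f) _ x)) lin_comb3 mul1r mul1r.
Qed.

Lemma sesquilinear_sum (R : realType) Q (I : Type) (r : seq I) (a : I -> R[i])
    (f : I -> R -> R[i]) (g : R -> R[i]) :
  sesquilinear_on_trig Q -> (forall i, trig_poly (f i)) -> trig_poly g ->
  trig_poly (fun x => \sum_(i <- r) a i * f i x) /\
  Q (fun x => \sum_(i <- r) a i * f i x) g =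
    (fun x => \sum_(i <- r) a i * Q (f i) g x).
Proof.
move=> [TQ lQ _] Tf Tg.
have T0 : @trig_poly R (fun=> 0) by rewrite -trig_nil; exact: trig_polyP.
elim: r => [|i r [IT IQ]].
  under eq_fun do rewrite big_nil.
  under [RHS]eq_fun do rewrite big_nil.
  split => //; have := lQ (-1) _ _ _ T0 T0 Tg.
  under eq_fun do rewrite mulr0 addr0.
  by move=> ->; apply/funext => x; rewrite mulN1r addNr.
under eq_fun do rewrite big_cons.
under [RHS]eq_fun do rewrite big_cons.
by split; [exact: trig_poly_lin|rewrite lQ // IQ].
Qed.

Lemma form_mxP (R : realType) Q (N : nat) (a : 'cV[R[i]]_N) (x : R) :
  sesquilinear_on_trig Q ->
  Q (tpoly a) (tpoly a) x =
  ((map_mx conjc a)^T *m form_mx N Q x *m a) 0 0.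
Proof.
move=> sQ; have [TQ lQ cQ] := sQ.
have Te (j : 'I_N) : @trig_poly R (cexp j.+1%:Z) := trig_poly_cexp _ _.
have tE : tpoly a = (fun x => \sum_(j < N) a j 0 * cexp j.+1%:Z x) by [].
have S g := sesquilinear_sum (index_enum 'I_N) (fun j => a j 0) sQ Te (g := g).
have Ta : trig_poly (tpoly a) by have [] := S _ (trig_poly_cexp R 0).
rewrite {1}tE (S _ Ta).2 mxE; apply: eq_bigr => k _.
rewrite mulrC; congr (_ * _); rewrite (cQ _ _ Ta (Te k)) tE (S _ (Te k)).2.
rewrite mxE rmorph_sum; apply: eq_bigr => j _ /=.
by rewrite !mxE rmorphM /= (cQ _ _ (Te j) (Te k)).
Qed.

Lemma form_mx_herm (R : realType) Q (N : nat) (x : R) :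
  sesquilinear_on_trig Q ->
  (map_mx conjc (form_mx N Q x))^T = form_mx N Q x.
Proof.
move=> [_ _ cQ]; apply/matrixP => j k; rewrite !mxE -[LHS]/((fun y => conjc (Q _ _ y)) x).
by rewrite -cQ //; exact: trig_poly_cexp.
Qed.

Lemma Gamma_mx_unit (R : realType) (N : nat) (x : R) :
  form_mx N (@Gamma R) x \in unitmx.
Proof.
pose B : 'M[R[i]]_N := \matrix_(j, k) ((k <= j)%:R * conjc (cexp j.+1%:Z x)).
have nz n : cexp n x != 0 :> R[i].
  apply/eqP => e; have := cexpD (- n) n x.
  by rewrite e mulr0 addNr cexp0 => /eqP; rewrite oner_eq0.
have Bt : is_trig_mx B.
  by apply/is_trig_mxP => j k jk; rewrite mxE leqNgt jk mul0r.
have -> : form_mx N (@Gamma R) x = B *m (map_mx conjc B)^T.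
  apply/matrixP => j k; rewrite !mxE Gamma_cexp.
  transitivity (conjc (cexp j.+1%:Z x) * cexp k.+1%:Z x * (minn j k).+1%:R).
    rewrite -cexpN [cexp (- _) _ * _]mulrC -cexpD; congr (_ * _).
    have -> : `|k.+1%:Z| + `|j.+1%:Z| - `|k.+1%:Z - j.+1%:Z| =
              ((minn j k).+1 * 2)%N :> int by lia.
    by rewrite -pmulrn natrM mulrC mulfK // pnatr_eq0.
  have -> : (minn j k).+1 = (\sum_(l < N) ((l <= j) && (l <= k)))%N.
    have mN : ((minn j k).+1 <= N)%N by rewrite gtn_min ltn_ord.
    have {1}<- : (\sum_(l < (minn j k).+1) 1 = (minn j k).+1)%N.
      by rewrite sum1_card card_ord.
    rewrite (big_ord_widen N (fun=> 1%N) mN).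
    by rewrite big_mkcond; apply: eq_bigr => l _; rewrite ltnS leq_min; case: ifP.
  rewrite natr_sum mulr_sumr; apply: eq_bigr => l _.
  rewrite !mxE rmorphM rmorph_nat.
  rewrite -[X in _ * (_ * X)]/(conjc (conjc (cexp k.+1%:Z x))) conjcK.
  by rewrite -mulnb natrM; ring.
rewrite unitmxE det_mulmx det_tr det_map_mx unitrM !unitfE fmorph_eq0 andbb.
rewrite det_trig // prodf_seq_neq0; apply/allP => j _ /=.
by rewrite mxE leqnn mul1r -cexpN nz.
Qed.

(* Main.v *)
Require Import Defs.
From HB Require Import structures.
From mathcomp Require Import all_boot all_order all_algebra.
From mathcomp Require Import complex.
From mathcomp Require Import all_classical all_reals all_analysis.
From mathcomp Require Import ring zify.

Import Order.TTheory GRing.Theory Num.Theory numFieldNormedType.Exports.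

Local Open Scope classical_set_scope.
Local Open Scope ring_scope.

Set Implicit Arguments.
Unset Strict Implicit.
Unset Printing Implicit Defensive.

(** Write [e_n] for [cexp n]. The number [(|n| + |m| - |n - m|) / 2] counts the
nonzero integers between [0] and both [n] and [m]; call it [overlap n m]. It is
[min(|n|, |m|)] when [n] and [m] have the same sign and [0] otherwise. At a
pair [(e_n, e_m)] one finds, up to the common factor [e_(n - m)]:
- [overlap n m] for [Gamma] ([Gamma_overlap]);
- [(overlap n m) ^ 2] for [Gamma12] ([Gamma12_overlap]), since [L1]
  multiplies each exponential by minus the modulus of its frequency;
- [(w ^+ 2 / 2) cos x * overlap n m] for the contribution of the drift
  ([iter_carre_bdx_cexp]). The drift shifts frequencies by one in either
  direction, and everything reduces to a pair of discrete identities for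
  [overlap] ([overlap_drift_up], [overlap_drift_down]).

All these forms are diagonalized at once by a layer-cake decomposition. Since
[overlap n m] is the number of levels [l >= 0] that lie below both [n] and [m],
or below both [- n] and [- m], and [k ^ 2] is the sum of the first [k] odd
numbers, each of them is a weighted sum over [l] of the squared moduli of the
two tails of [f], the parts of [f] with frequencies [> l] and [< - l]
([layered_trig]). The weights at level [l] are [1] for [Gamma], [2 l + 1] for
[Gamma12] and [2 l + 1 + (w ^+ 2 / 2) cos x] for [GammaL2 w]. Hence:
- the drift identity and the bound [GammaL2 >= (1 - w ^+ 2 / 2) Gamma] hold for
  every trigonometric polynomial, by comparing weights
  ([GammaL2_sub_Gamma12], [curvature_trig]);
- the bound is attained by [e_1] at [x = pi], which makes the constant optimal
  as soon as [1 <= N] ([BE_curvature]);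
- on the span of [e_1, ..., e_N] the matrices factor as [B D B^*], with the
  same [B] and with [D] the diagonal matrix of the weights ([form_mx_layered]).
  The curvature operator is then similar to [D], whose entries are the
  [N] announced eigenvalues ([curvature_op_eigenvalue]). *)

(** * Overlap of two frequencies *)

Definition pos_part (n : int) : nat := if n is Posz k then k else 0%N.

Definition overlap (n m : int) : nat :=
  (minn (pos_part n) (pos_part m) + minn (pos_part (- n)) (pos_part (- m)))%N.

Lemma pos_partE (n : int) : (pos_part n)%:Z = Num.max n 0.
Proof. by case: n => k; rewrite /pos_part; lia. Qed.

Lemma pos_part_leq (n : int) :
  (pos_part n <= `|n|)%N /\ (pos_part (- n) <= `|n|)%N.
Proof. by have := pos_partE n; have := pos_partE (- n); lia. Qed.

Lemma minn_pos_part_opp (n m : int) :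
  minn (pos_part n) (pos_part m) = 0%N \/
  minn (pos_part (- n)) (pos_part (- m)) = 0%N.
Proof.
by have := pos_partE n; have := pos_partE m;
   have := pos_partE (- n); have := pos_partE (- m); lia.
Qed.

Lemma overlapE (n m : int) : `|n| + `|m| - `|n - m| = (overlap n m * 2)%N.
Proof.
rewrite /overlap; have := pos_partE n; have := pos_partE m.
by have := pos_partE (- n); have := pos_partE (- m); lia.
Qed.

Lemma overlapN (n m : int) : overlap (- n) (- m) = overlap n m.
Proof. by rewrite /overlap !opprK addnC. Qed.

Lemma overlapC (n m : int) : overlap n m = overlap m n.
Proof. by rewrite /overlap minnC [X in (_ + X)%N]minnC. Qed.

Lemma overlap_ge0 (n m : int) : 0 <= n -> n <= m -> (overlap n m)%:Z = n.
Proof.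
move=> n0 nm; rewrite /overlap; have := pos_partE n; have := pos_partE m.
by have := pos_partE (- n); have := pos_partE (- m); lia.
Qed.

Lemma overlap_le0 (n m : int) : m <= n -> n <= 0 -> (overlap n m)%:Z = - n.
Proof. by move=> mn n0; rewrite -overlapN overlap_ge0; lia. Qed.

Lemma overlap_opp (n m : int) : n <= 0 <= m -> overlap n m = 0%N.
Proof.
move=> nm; rewrite /overlap; have := pos_partE n; have := pos_partE m.
by have := pos_partE (- n); have := pos_partE (- m); lia.
Qed.

(** This is, up to the factor [- w ^+ 2 / 4], the coefficient of [e_(n - m + 1)]
in the drift contribution at [(e_n, e_m)]. *)
Lemma overlap_drift_up (n m : int) :
  (n - m) * (overlap n m)%:Z - n * (overlap (n + 1) m)%:Z
    + m * (overlap n (m - 1))%:Z = - (overlap n m)%:Z.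
Proof.
have [->|n0] := eqVneq n 0.
  have Z k : overlap 0 k = 0%N.
    by have [k0|k0] := lerP 0 k; [|rewrite overlapC]; rewrite overlap_opp; lia.
  by rewrite !Z; lia.
have [->|m0] := eqVneq m 0.
  have Z k : overlap k 0 = 0%N.
    by have [k0|k0] := lerP 0 k; [rewrite overlapC|]; rewrite overlap_opp; lia.
  by rewrite !Z; lia.
(* Both frequencies are now nonzero, so that a shift by one preserves, in the *)
(* weak sense, their signs and, when these agree, their order.                *)
have [np|nn] := lerP 0 n; have [mp|mn] := lerP 0 m.
- have [nm|nm] := ltrP n m; first by rewrite !overlap_ge0; [ring|lia..].
  by rewrite !(overlapC _ m) (overlapC n) !overlap_ge0; [ring|lia..].
- by rewrite !(overlapC _ m) (overlapC n) !overlap_opp; lia.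
- by rewrite !overlap_opp; lia.
- have [nm|nm] := ltrP n m; last by rewrite !overlap_le0; [ring|lia..].
  by rewrite !(overlapC _ m) (overlapC n) !overlap_le0; [ring|lia..].
Qed.

(** The reflection [x |-> - x] of the circle exchanges the two frequency shifts:
this is the previous identity at [(- n, - m)]. *)
Lemma overlap_drift_down (n m : int) :
  (n - m) * (overlap n m)%:Z - n * (overlap (n - 1) m)%:Z
    + m * (overlap n (m + 1))%:Z = (overlap n m)%:Z.
Proof.
have := overlap_drift_up (- n) (- m).
rewrite (_ : - n + 1 = - (n - 1)); last by ring.
rewrite (_ : - m - 1 = - (m + 1)); last by ring.
by rewrite !overlapN => e; apply: oppr_inj; rewrite -e; ring.
Qed.

(** * The forms on pairs of exponentials *)

Lemma conjcM (R : realType) (a b : R[i]) : conjc (a * b) = conjc a * conjc b.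
Proof. exact: rmorphM. Qed.

Lemma sesquilinear_trigl (R : realType) Q s g (x : R) :
  sesquilinear_on_trig Q -> trig_poly g ->
  Q (trig s) g x = \sum_(p <- s) p.2 * Q (cexp p.1) g x.
Proof.
move=> sQ Tg; have [_ e] := sesquilinear_sum s (fun p : int * R[i] => p.2) sQ
  (fun p => trig_poly_cexp R p.1) Tg.
by rewrite /trig e.
Qed.

Lemma sesquilinear_trigr (R : realType) Q s f (x : R) :
  sesquilinear_on_trig Q -> trig_poly f ->
  Q f (trig s) x = \sum_(p <- s) conjc p.2 * Q f (cexp p.1) x.
Proof.
move=> sQ Tf; have [_ _ cQ] := sQ; rewrite (cQ (trig s)) //; last exact: trig_polyP.
rewrite sesquilinear_trigl // rmorph_sum; apply: eq_bigr => p _.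
by rewrite rmorphM /= (cQ (cexp p.1)) //; exact: trig_poly_cexp.
Qed.

Lemma Gamma_overlap (R : realType) (n m : int) (x : R) :
  Gamma (cexp n) (cexp m) x = (overlap n m)%:R * cexp (n - m) x.
Proof.
rewrite Gamma_cexp overlapE mulrC; congr (_ * _).
by rewrite -pmulrn natrM mulrC mulfK ?pnatr_eq0.
Qed.

Lemma Gamma_trig1 (R : realType) (n m : int) :
  Gamma (cexp n) (cexp m) = trig [:: (n - m, (overlap n m)%:R)] :> (R -> R[i]).
Proof. by apply/funext => x; rewrite Gamma_overlap /trig big_seq1. Qed.

(** [L1] contributes the factors [- |n - m|], [- |m|] and [- |n|] to the three
terms. These reassemble to twice the overlap, so that [Gamma] is multiplied by
[overlap n m]. *)
Lemma Gamma12_overlap (R : realType) (n m : int) (x : R) :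
  Gamma12 (cexp n) (cexp m) x = ((overlap n m) ^ 2)%:R * cexp (n - m) x.
Proof.
have sG := sesquilinear_Gamma R; have Tc := trig_poly_cexp R.
rewrite /Gamma12 /iter_carre Gamma_trig1.
rewrite -[in L1 (cexp m)]trig_cexp -[in L1 (cexp n)]trig_cexp !L1_trig.
rewrite sesquilinear_trigl // sesquilinear_trigr // /trig !big_cons !big_nil /=.
rewrite !Gamma_overlap rmorphM rmorph_int rmorph1 !addr0 !mulr1.
have := congr1 (fun k : int => k%:~R : R[i]) (overlapE n m).
rewrite /= -pmulrn !(intrD, intrN) natrM natrX => e.
set g := (overlap n m)%:R in e *.
transitivity (2^-1 * (`|n|%:~R + `|m|%:~R - `|n - m|%:~R) * g * cexp (n - m) x).
  by ring.
by rewrite e; field.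
Qed.

(** The drift is a sine, hence a combination of [e_1] and [e_(-1)]: it moves a
frequency by one in both directions. *)
Lemma bdx_monomial (R : realType) (w : R) k (a : R[i]) :
  bdx w (trig [:: (k, a)]) =
  trig [:: (k + 1, - (w ^+ 2 / 2)%:C%C * k%:~R * a);
           (k - 1, (w ^+ 2 / 2)%:C%C * k%:~R * a)].
Proof.
apply/funext => x.
rewrite /bdx dx_trig /dmap /trig /= !big_cons !big_nil /= !addr0.
rewrite !cexpD cexpN driftE.
have -> : (- w ^+ 2 * sin x)%:C%C =
  'i%C * (w ^+ 2 / 2)%:C%C * (cexp 1 x - conjc (cexp 1 x)) :> R[i].
  by rewrite /cexp mul1r; apply/eqP; rewrite eq_complex /=; apply/andP; split;
    apply/eqP; field.
have -> : Complex 0 k%:~R = 'i%C * k%:~R :> R[i].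
  rewrite -(rmorph_int (@real_complex R)); apply/eqP; rewrite eq_complex /=.
  by apply/andP; split; apply/eqP; ring.
have i2 : 'i%C * 'i%C = -1 :> R[i].
  by apply/eqP; rewrite eq_complex /=; apply/andP; split; apply/eqP; ring.
by ring: i2.
Qed.

(** The three terms have frequencies [n - m + 1] and [n - m - 1] only. The
identities for [overlap] evaluate the two coefficients, and [e_1 + e_(-1)]
gives the cosine. *)
Lemma iter_carre_bdx_cexp (R : realType) (w : R) (n m : int) x :
  iter_carre (bdx w) (cexp n) (cexp m) x =
  (w ^+ 2 / 2 * cos x)%:C%C * Gamma (cexp n) (cexp m) x.
Proof.
have sG := sesquilinear_Gamma R; have Tc := trig_poly_cexp R.
rewrite /iter_carre Gamma_trig1.
rewrite -[in bdx w (cexp m)]trig_cexp -[in bdx w (cexp n)]trig_cexp !bdx_monomial.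
rewrite sesquilinear_trigl // sesquilinear_trigr // /trig !big_cons !big_nil /=.
rewrite !Gamma_overlap.
have -> : (w ^+ 2 / 2 * cos x)%:C%C =
    (w ^+ 2 / 2)%:C%C * ((cexp 1 x + cexp (-1) x) / 2) :> R[i].
  by rewrite cexpN -ReJ_add /cexp /= mul1r rmorphM.
have conjN (y : R[i]) : conjc (- y) = - conjc y := rmorphN _ _.
have conjZ (k : int) : conjc k%:~R = k%:~R :> R[i] := rmorph_int _ _.
rewrite !(conjcM, conjN, conjZ) !conjc_real !mulr1 !addr0 !(opprD, opprK) !cexpD.
set c := (w ^+ 2 / 2)%:C%C; set en := cexp n x; set em := cexp (- m) x.
have := congr1 (fun k : int => k%:~R : R[i]) (overlap_drift_up n m).
have := congr1 (fun k : int => k%:~R : R[i]) (overlap_drift_down n m).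
rewrite !(intrD, intrM, intrN) -!pmulrn => down up.
set e := cexp 1 x; set e' := cexp (-1) x.
apply/eqP; rewrite -subr_eq0; apply/eqP.
transitivity (2^-1 * c * en * em *
  (e' * (((n%:~R - m%:~R) * (overlap n m)%:R - n%:~R * (overlap (n - 1) m)%:R
          + m%:~R * (overlap n (m + 1))%:R) - (overlap n m)%:R)
   - e * (((n%:~R - m%:~R) * (overlap n m)%:R - n%:~R * (overlap (n + 1) m)%:R
          + m%:~R * (overlap n (m - 1))%:R) + (overlap n m)%:R))).
  by ring.
by rewrite up down addNr subrr !mulr0 subrr mulr0.
Qed.

(** * Layer-cake decomposition *)

(** [r l] is the weight of the level [l], that is, of the pairs of frequencies
that are both [> l] or both [< - l]. *)
Definition layered (R : realType) (r : nat -> R)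
    (Q : (R -> R[i]) -> (R -> R[i]) -> R -> R[i]) (x : R) := forall n m : int,
  Q (cexp n) (cexp m) x =
  (\sum_(l < minn (pos_part n) (pos_part m)) (r l)%:C%C
   + \sum_(l < minn (pos_part (- n)) (pos_part (- m))) (r l)%:C%C)
  * cexp (n - m) x.

Lemma layered_Gamma (R : realType) (x : R) : layered (fun=> 1) (@Gamma R) x.
Proof. by move=> n m; rewrite Gamma_overlap !sumr_const !card_ord -natrD. Qed.

Lemma sum_odd (R : realType) (k : nat) :
  \sum_(l < k) (2 * l%:R + 1 : R) = (k ^ 2)%:R.
Proof.
elim: k => [|k IHk]; first by rewrite big_ord0.
by rewrite big_ord_recr /= IHk !natrX -natr1; ring.
Qed.

(** One of the two summands of [overlap n m] vanishes, so that its square is the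
sum of their squares. *)
Lemma layered_Gamma12 (R : realType) (x : R) :
  layered (fun l => 2 * l%:R + 1) (@Gamma12 R) x.
Proof.
move=> n m; rewrite Gamma12_overlap -!rmorph_sum /= !sum_odd !rmorph_nat.
rewrite -natrD /overlap; congr (_%:R * _).
by case: (minn_pos_part_opp n m) => ->; rewrite ?addn0 ?add0n.
Qed.

Lemma layered_bdx (R : realType) (w x : R) :
  layered (fun=> w ^+ 2 / 2 * cos x) (iter_carre (bdx w)) x.
Proof.
move=> n m; rewrite iter_carre_bdx_cexp Gamma_overlap mulrA.
by rewrite !sumr_const !card_ord -mulrnDr -/(overlap n m) mulr_natr.
Qed.

Lemma layered_GammaL2 (R : realType) (w x : R) :
  layered (fun l => 2 * l%:R + 1 + w ^+ 2 / 2 * cos x) (GammaL2 w) x.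
Proof.
move=> n m; rewrite /GammaL2 layered_Gamma12 (layered_bdx w) -mulrDl addrACA.
rewrite -!big_split.
by congr ((_ + _) * _); apply: eq_bigr => l _; rewrite /= -rmorphD.
Qed.

(** The levels below [minn a b] are those below both [a] and [b]; this splits
the dependence on [a] and [b] into a sum of products. *)
Lemma sum_minn (K : pzSemiRingType) (f : nat -> K) (a b M : nat) :
  (minn a b <= M)%N ->
  \sum_(l < minn a b) f l =
  \sum_(l < M) f l * ((l < a)%N%:R * (l < b)%N%:R).
Proof.
move=> abM; rewrite (big_ord_widen M f abM) big_mkcond.
apply: eq_bigr => l _; rewrite leq_min -natrM mulnb.
by case: ifP; rewrite ?mulr1 ?mulr0.
Qed.

Lemma trig_filter (R : realType) (P : pred int) s (x : R) :
  trig [seq p <- s | P p.1] x = \sum_(p <- s) (P p.1)%:R * (p.2 * cexp p.1 x).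
Proof.
rewrite /trig big_filter big_mkcond; apply: eq_bigr => p _.
by case: (P _); rewrite ?mul1r ?mul0r.
Qed.

Lemma normsq_trig_filter (R : realType) (P : pred int) s (x : R) :
  `|trig [seq p <- s | P p.1] x| ^+ 2 =
  \sum_(p <- s) \sum_(q <- s)
    p.2 * conjc q.2 * ((P p.1)%:R * (P q.1)%:R) * cexp (p.1 - q.1) x.
Proof.
rewrite sqr_normc trig_filter rmorph_sum /= mulr_suml; apply: eq_bigr => p _.
rewrite mulr_sumr; apply: eq_bigr => q _.
by rewrite !conjcM conjc_nat cexpD cexpN; ring.
Qed.

(** A layered form is diagonal in the tails of [f], with its weights as
coefficients; two layered forms are therefore compared weight by weight. *)
Lemma layered_trig (R : realType) (r : nat -> R) Q s x (M : nat) :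
  sesquilinear_on_trig Q -> layered r Q x ->
  (forall p, p \in s -> (`|p.1| <= M)%N) ->
  Q (trig s) (trig s) x =
  \sum_(l < M) (r l)%:C%C *
    (`|trig [seq p <- s | (l < pos_part p.1)%N] x| ^+ 2
     + `|trig [seq p <- s | (l < pos_part (- p.1))%N] x| ^+ 2).
Proof.
move=> sQ lQ sM.
under [RHS]eq_bigr => l _ do
  rewrite (normsq_trig_filter (fun n => (l < pos_part n)%N))
  (normsq_trig_filter (fun n => (l < pos_part (- n))%N)) -big_split mulr_sumr.
rewrite sesquilinear_trigl //; last exact: trig_polyP.
rewrite [RHS]exchange_big big_seq [RHS]big_seq; apply: eq_bigr => p ps.
under [RHS]eq_bigr => l _ do rewrite -big_split mulr_sumr.
rewrite sesquilinear_trigr //; last exact: trig_poly_cexp.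
rewrite mulr_sumr exchange_big big_seq [RHS]big_seq; apply: eq_bigr => q qs.
have [pM nM] := pos_part_leq p.1.
rewrite lQ (sum_minn (fun l => (r l)%:C%C) (M := M)); last first.
  by rewrite geq_min (leq_trans pM) ?sM.
rewrite (sum_minn (fun l => (r l)%:C%C) (M := M)); last first.
  by rewrite geq_min (leq_trans nM) ?sM.
rewrite -big_split mulr_suml !mulr_sumr /=; apply: eq_bigr => l _.
by ring.
Qed.

Lemma trig_freq_bound (R : realType) (s : seq (int * R[i])) :
  exists M : nat, forall p, p \in s -> (`|p.1| <= M)%N.
Proof.
exists (\sum_(p <- s) `|p.1|)%N => p ps.
by rewrite (perm_big _ (perm_to_rem ps)) big_cons leq_addr.
Qed.

(** * Curvature bounds *)

Lemma GammaL2_sub_Gamma12 (R : realType) (w : R) f x : trig_poly f ->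
  GammaL2 w f f x - Gamma12 f f x = (w ^+ 2 / 2 * cos x)%:C%C * Gamma f f x.
Proof.
move=> [s _ <-]; rewrite /GammaL2 addrC addKr; have [M sM] := trig_freq_bound s.
have sB := sesquilinear_iter_carre (real_operator_bdx w).
rewrite (layered_trig sB (layered_bdx w x) sM).
rewrite (layered_trig (sesquilinear_Gamma R) (layered_Gamma x) sM).
by rewrite mulr_sumr; apply: eq_bigr => l _; rewrite mul1r.
Qed.

(** The difference of the weights at level [l] is
[2 l + (w ^+ 2 / 2) (1 + cos x)], which is nonnegative. *)
Lemma curvature_trig (R : realType) (w : R) f x : trig_poly f ->
  (1 - w ^+ 2 / 2)%:C%C * Gamma f f x <= GammaL2 w f f x.
Proof.
move=> [s _ <-]; have [M sM] := trig_freq_bound s.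
rewrite (layered_trig (sesquilinear_GammaL2 w) (layered_GammaL2 w x) sM).
rewrite (layered_trig (sesquilinear_Gamma R) (layered_Gamma x) sM).
rewrite mulr_sumr; apply: ler_sum => l _; rewrite mul1r.
apply: ler_wpM2r; first by rewrite addr_ge0 // exprn_ge0.
rewrite lecR -subr_ge0.
rewrite (_ : _ - _ = 2 * l%:R + w ^+ 2 / 2 * (1 + cos x)); last by ring.
have c1 : 0 <= 1 + cos x by rewrite addrC -lerBlDr sub0r cos_geN1.
by rewrite addr_ge0 // mulr_ge0 // divr_ge0 // sqr_ge0.
Qed.

Lemma Tplus_trig_poly (R : realType) (N : nat) f : @Tplus R N f -> trig_poly f.
Proof.
move=> [a _ <-]; exists [seq (j.+1%:Z, a j 0) | j : 'I_N <- index_enum _] => //.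
by apply/funext => x; rewrite /trig big_map.
Qed.

Lemma cexp1_Tplus (R : realType) (N : nat) : (1 <= N)%N -> Tplus N (@cexp R 1).
Proof.
move=> hN; exists (delta_mx (Ordinal hN) 0) => //; apply/funext => x.
rewrite /tpoly (bigD1 (Ordinal hN)) //= mxE !eqxx mul1r big1 ?addr0 // => j nj.
by rewrite mxE (negbTE nj) mul0r.
Qed.

(** Only the level [0] contributes at [e_1], and its weight
[1 + (w ^+ 2 / 2) cos x] is smallest at [x = pi]. *)
Lemma BE_curvature (R : realType) (w : R) (N : nat) : (1 <= N)%N ->
  is_BE_curvature w N (1 - w ^+ 2 / 2).
Proof.
move=> hN; split=> [f Tf x|k kb].
  by apply: curvature_trig; exact: Tplus_trig_poly Tf.
have := kb _ (cexp1_Tplus R hN) pi; rewrite layered_GammaL2 layered_Gamma /=.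
rewrite !big_ord0 !big_ord1 subrr cexp0 !addr0 !mulr1.
by rewrite lecR cospi mulr0 add0r mulrN1.
Qed.

(** * Spectrum of the curvature operator *)

Lemma eigenvalue_similar_diag (F : fieldType) (n : nat) (P : 'M[F]_n)
    (d : 'rV[F]_n) a : P \in unitmx ->
  eigenvalue (invmx P *m diag_mx d *m P) a <-> exists i, a = d 0 i.
Proof.
move=> Pu; split=> [/eigenvalueP[v ve v0]|[i ->]].
  pose u := v *m invmx P.
  have u0 : u != 0.
    by apply: contraNneq v0 => u0; rewrite -[v](mulmxKV Pu) -/u u0 mul0mx.
  have ue : u *m diag_mx d = a *: u.
    by rewrite /u scalemxAl -ve !mulmxA mulmxK.
  have [i ui] : exists i, u 0 i != 0 by apply/rV0Pn.
  exists i; apply: (mulIf ui).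
  by have /rowP/(_ i) := ue; rewrite mul_mx_diag !mxE mulrC => <-.
apply/eigenvalueP; exists (delta_mx 0 i *m P).
  rewrite !mulmxA mulmxK // scalemxAl; congr (_ *m _).
  apply/rowP => j; rewrite mul_mx_diag !mxE eqxx /= mulrC.
  by case: eqVneq => [->|]; rewrite ?mulr0.
apply/eqP => e; have /rowP/(_ i) : delta_mx 0 i = 0 :> 'rV[F]_n.
  by rewrite -(mulmxK Pu (delta_mx 0 i)) e mul0mx.
by rewrite !mxE !eqxx => /eqP; rewrite oner_eq0.
Qed.

(** The left factor cancels: [(B C)^-1 (B D C) = C^-1 D C]. *)
Lemma eigenvalue_pencil_diag (F : fieldType) (n : nat) (B C : 'M[F]_n)
    (d : 'rV[F]_n) a : B *m C \in unitmx ->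
  eigenvalue (invmx (B *m C) *m (B *m diag_mx d *m C)) a <->
  exists i, a = d 0 i.
Proof.
move=> BC; have := BC; rewrite unitmx_mul => /andP[_ Cu].
rewrite -(eigenvalue_similar_diag d a Cu).
rewrite (_ : invmx _ *m _ = invmx C *m diag_mx d *m C) //.
by rewrite -[RHS](mulKmx BC) !mulmxA mulmxK.
Qed.

(** Its adjoint sends the coefficients of [f] to the values at [x] of the tails
of [f] with frequencies [> l], for [l < N]. *)
Definition tail_mx (R : realType) (N : nat) (x : R) : 'M[R[i]]_N :=
  \matrix_(j, l) ((l <= j)%N%:R * conjc (cexp j.+1%:Z x)).

(** The layer-cake decomposition in matrix form; frequencies are positive here,
so that the second family of tails is absent. *)
Lemma form_mx_layered (R : realType) (N : nat) r Q (x : R) : layered r Q x ->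
  form_mx N Q x =
  tail_mx N x *m diag_mx (\row_l (r l)%:C%C) *m (map_mx conjc (tail_mx N x))^T.
Proof.
move=> lQ; apply/matrixP => j k; rewrite mul_mx_diag !mxE lQ /=.
rewrite minnn big_ord0 addr0 (sum_minn (fun l => (r l)%:C%C) (M := N)).
  rewrite mulr_suml; apply: eq_bigr => l _; rewrite !mxE !ltnS.
  by rewrite conjcM conjc_nat conjcK cexpD cexpN; ring.
by rewrite geq_min ltn_ord.
Qed.

Lemma curvature_op_eigenvalue (R : realType) (w : R) N (x : R) (a : R[i]) :
  eigenvalue (curvature_op w N x) a <->
  exists l : 'I_N, a = (2 * l%:R + 1 + w ^+ 2 / 2 * cos x)%:C%C.
Proof.
have G : form_mx N (@Gamma R) x = tail_mx N x *m (map_mx conjc (tail_mx N x))^T.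
  rewrite (form_mx_layered N (layered_Gamma x)) (_ : diag_mx _ = 1%:M) ?mulmx1 //.
  by apply/matrixP => j k; rewrite !mxE.
have := Gamma_mx_unit N x.
rewrite /curvature_op (form_mx_layered N (layered_GammaL2 w x)) G => Gu.
rewrite (eigenvalue_pencil_diag _ a Gu).
by split=> -[l ->]; exists l; rewrite ?mxE.
Qed.

Theorem theoremE (R : realType) (w : R) (N : nat) (hN : (1 <= N)%N) :
  [/\ (forall f : R -> R[i], Tplus N f -> forall x : R,
         GammaL2 w f f x - Gamma12 f f x =
           (w ^+ 2 / 2 * cos x)%:C%C * Gamma f f x),
      (forall (x : R) (l : R[i]),
         eigenvalue (curvature_op w N x) l <->
         exists2 k : nat, (1 <= k <= N)%N &
           l = ((2 * k%:R - 1) + w ^+ 2 / 2 * cos x)%:C%C),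
      is_BE_curvature w N (1 - w ^+ 2 / 2) &
      (w ^+ 2 < 2 -> CD w (1 - w ^+ 2 / 2))].
Proof.
split.
- by move=> f /Tplus_trig_poly Tf x; exact: GammaL2_sub_Gamma12.
(* Levels start at 0 and the index of the eigenvalues at 1: k = l + 1. *)
- move=> x l; rewrite curvature_op_eigenvalue; split=> [[j ->]|[[//|k] kN ->]].
    exists j.+1; first by rewrite ltn_ord.
    by rewrite -natr1; congr (_%:C%C); ring.
  by exists (Ordinal kN); rewrite -natr1; congr (_%:C%C); ring.
- exact: BE_curvature.
- by move=> _ f Tf _ x; exact: curvature_trig.
Qed.
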